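(* Let $H$ be a complex Hilbert space, and let $\{f_k\}_{k=1}^\infty$ and $\{g_k\}_{k=1}^\infty$ be Bessel sequences in $H$ such that the cross-Gram matrix $\{\langle f_k,g_j\rangle\}_{j,k=1}^\infty$ associated to these sequences is bounded and invertible as an operator on $\ell^2(\mathbb{N})$. Then the following hold: (i) If $\{f_k\}_{k=1}^\infty$ is a Riesz basis for $H$, then $\{g_k\}_{k=1}^\infty$ is a Riesz basis for $H$. (ii) If $\{f_k\}_{k=1}^\infty$ is a frame for $H$ and $\{g_k\}_{k=1}^\infty$ is complete in $H$, then $\{g_k\}_{k=1}^\infty$ is a frame for $H$.
   Context: Inner products are linear in the first argument. A sequence $\{f_k\}_{k=1}^\infty\subset H$ is a frame for $H$ if there are constants $A,B>0$ with $A\|f\|^2\le\sum_{k=1}^\infty|\langle f,f_k\rangle|^2\le B\|f\|^2$ for all $f\in H$; it is a Bessel sequence if the second inequality holds for some $B>0$ and all $f\in H$. A Riesz basis for $H$ is a family of the form $\{Ue_k\}_{k=1}^\infty$, where $\{e_k\}_{k=1}^\infty$ is an orthonormal basis for $H$ and $U:H\to H$ is a bounded bijective linear operator. A sequence is complete in $H$ if its closed linear span is $H$. The cross-Gram matrix has $(j,k)$ entry $\langle f_k,g_j\rangle$ and defines the operator $\{c_k\}_{k=1}^\infty\mapsto\left\{\sum_{k=1}^\infty c_k\langle f_k,g_j\rangle\right\}_{j=1}^\infty$ on $\ell^2(\mathbb{N})$. Invertible means bijective with bounded inverse. *)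

(* Defs.v *)
From Stdlib Require Export Reals.
From Coquelicot Require Export Coquelicot.
From Corelib Require Export ssreflect ssrfun.

Open Scope R_scope.

Notation C_seq := (nat -> C).

(* Together with completeness of [H], this makes [H] a complex Hilbert space:
   [ip_norm] forces the norm (and hence the topology) of the normed module to be
   the one induced by the inner product; definiteness is then [norm_eq_zero]. *)
Record is_inner_product {H : NormedModule C_AbsRing} (ip : H -> H -> C) : Prop :=
  Is_inner_product {
    ip_plus_l : forall x y z : H, ip (plus x y) z = Cplus (ip x z) (ip y z);
    ip_scal_l : forall (a : C) (x y : H), ip (scal a x) y = Cmult a (ip x y);
    ip_conj : forall x y : H, ip y x = Cconj (ip x y);
    ip_norm : forall x : H, ip x x = RtoC (norm x ^ 2)
  }.

(* [Series] is a junk value on divergent series, so an inequality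
   sum <= B < +oo is rendered as convergence together with the bound. *)
Definition is_bessel {H : NormedModule C_AbsRing} (ip : H -> H -> C)
    (f : nat -> H) : Prop :=
  exists B : R, 0 < B /\
    forall x : H,
      ex_series (fun k => Cmod (ip x (f k)) ^ 2) /\
      Series (fun k => Cmod (ip x (f k)) ^ 2) <= B * norm x ^ 2.

Definition is_frame {H : NormedModule C_AbsRing} (ip : H -> H -> C)
    (f : nat -> H) : Prop :=
  exists A B : R, 0 < A /\ 0 < B /\
    forall x : H,
      ex_series (fun k => Cmod (ip x (f k)) ^ 2) /\
      A * norm x ^ 2 <= Series (fun k => Cmod (ip x (f k)) ^ 2) /\
      Series (fun k => Cmod (ip x (f k)) ^ 2) <= B * norm x ^ 2.

Definition in_span {H : NormedModule C_AbsRing} (f : nat -> H) (x : H) : Prop :=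
  exists (n : nat) (c : C_seq), x = sum_n (fun k => scal (c k) (f k)) n.

Definition in_closure {H : NormedModule C_AbsRing} (D : H -> Prop) (x : H) : Prop :=
  forall eps : posreal, exists y : H, D y /\ norm (minus x y) < eps.

(* Totality of the sequence, i.e. its closed linear span is [H]. *)
Definition complete_seq {H : NormedModule C_AbsRing} (f : nat -> H) : Prop :=
  forall x : H, in_closure (in_span f) x.

Definition is_orthonormal {H : NormedModule C_AbsRing} (ip : H -> H -> C)
    (e : nat -> H) : Prop :=
  forall j k : nat, ip (e j) (e k) = if Nat.eqb j k then RtoC 1 else RtoC 0.

Definition is_orthonormal_basis {H : NormedModule C_AbsRing} (ip : H -> H -> C)
    (e : nat -> H) : Prop :=
  is_orthonormal ip e /\ complete_seq e.

(* Coquelicot's [is_linear] includes boundedness. *)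
Definition is_riesz_basis {H : NormedModule C_AbsRing} (ip : H -> H -> C)
    (f : nat -> H) : Prop :=
  exists (e : nat -> H) (U : H -> H),
    is_orthonormal_basis ip e /\ is_linear U /\ bijective U /\
    forall k : nat, f k = U (e k).

Definition in_l2 (c : C_seq) : Prop := ex_series (fun k => Cmod (c k) ^ 2).

Definition l2_norm (c : C_seq) : R := sqrt (Series (fun k => Cmod (c k) ^ 2)).

(* Operators on l2 are total maps on sequences whose values outside l2 are
   irrelevant. *)
Definition l2_bounded (T : C_seq -> C_seq) : Prop :=
  (forall c : C_seq, in_l2 c -> in_l2 (T c)) /\
  exists K : R, forall c : C_seq, in_l2 c -> l2_norm (T c) <= K * l2_norm c.

(* The inverse of a linear operator is linear, so it need not be required. *)
Definition l2_invertible (T : C_seq -> C_seq) : Prop :=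
  exists S : C_seq -> C_seq,
    l2_bounded S /\
    (forall c : C_seq, in_l2 c -> forall k, S (T c) k = c k) /\
    (forall d : C_seq, in_l2 d -> forall j, T (S d) j = d j).

(* The sum of a convergent complex series; junk if the series diverges. *)
Definition C_Series (a : C_seq) : C :=
  (Series (fun k => Re (a k)), Series (fun k => Im (a k))).

Definition matrix_op (M : nat -> nat -> C) (c : C_seq) : C_seq :=
  fun j => C_Series (fun k => Cmult (c k) (M j k)).

Definition matrix_bounded (M : nat -> nat -> C) : Prop :=
  (forall c : C_seq, in_l2 c ->
     forall j, @ex_series C_AbsRing C_NormedModule (fun k => Cmult (c k) (M j k))) /\
  l2_bounded (matrix_op M).

Definition cross_gram {H : NormedModule C_AbsRing} (ip : H -> H -> C)
    (f g : nat -> H) : nat -> nat -> C :=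
  fun j k => ip (f k) (g j).

(* Main.v *)
(** Write [T_f c = sum c_k f_k] and [C_g x = (<x, g_j>)_j], so that the cross-Gram
    operator is [G = C_g T_f].  If [T_f] maps l2 onto [H] (which holds for a frame,
    hence for a Riesz basis), then [x = T_f c] gives
    [|x|^2 <= B |c|^2 <= B K^2 |G c|^2 = B K^2 |C_g x|^2] with [K] a bound for the
    inverse of [G]; this is the lower frame bound for [g].
    Surjectivity of [G] makes [C_g] onto, so that [T_g] is injective; when [f] is a
    Riesz basis, composing [T_g] with the analysis operator of an orthonormal basis
    [e] yields a bounded bijection of [H] sending [e_k] to [g_k]. *)

From Stdlib Require Import Lra Lia Compare_dec FunctionalExtensionality ClassicalEpsilon.
Require Import Defs.

(** * Finite sums and series, real and complex *)

Lemma sum_n_m_morphism (G G' : AbelianMonoid) (phi : G -> G') (a : nat -> G) (n m : nat)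
  (phi0 : phi zero = zero) (phiD : forall x y : G, phi (plus x y) = plus (phi x) (phi y)) :
  phi (sum_n_m a n m) = sum_n_m (fun k => phi (a k)) n m.
Proof.
  elim: m => [|m IH].
  - case: n => [|n]; first by rewrite !sum_n_n.
    by rewrite !sum_n_m_zero; try lia.
  - case: (le_lt_dec n (S m)) => h.
    + by rewrite !sum_n_Sm // phiD IH.
    + by rewrite !sum_n_m_zero.
Qed.

Lemma is_series_linear (U V : NormedModule C_AbsRing) (l : U -> V) (a : nat -> U) (s : U) :
  is_linear l -> is_series a s -> is_series (fun k => l (a k)) (l s).
Proof.
  move=> hl ha; rewrite /is_series.
  apply: (filterlim_ext (fun n => l (sum_n a n))).
  - move=> n; apply: sum_n_m_morphism; first exact: linear_zero.
    exact: linear_plus.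
  - apply: filterlim_comp ha _; exact: linear_cont.
Qed.

Lemma is_series_unique_normed (V : NormedModule C_AbsRing) (a : nat -> V) (s s' : V) :
  is_series a s -> is_series a s' -> s = s'.
Proof. exact (filterlim_locally_unique (sum_n a) s s'). Qed.

Lemma pow2_le (x y : R) : 0 <= y -> x ^ 2 <= y ^ 2 -> x <= y.
Proof. move=> hy h; apply: Rsqr_incr_0_var => //; rewrite /Rsqr; lra. Qed.

Lemma im_le_Cmod (z : C) : Rabs (Im z) <= Cmod z.
Proof.
  apply: pow2_le; first exact: Cmod_ge_0.
  rewrite pow2_abs Cmod2_alt; have := pow2_ge_0 (Re z); lra.
Qed.

(** Links convergence in [C] to the componentwise sums out of which [C_Series] is built. *)
Lemma is_series_Re_Im (a : C_seq) (l : C) :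
  @is_series C_AbsRing C_NormedModule a l ->
  is_series (fun k => Re (a k)) (Re l) /\ is_series (fun k => Im (a k)) (Im l).
Proof.
  move=> ha.
  (* An additive functional dominated by the modulus is continuous, so it passes through the limit;
     [Re] and [Im] are the two instances. *)
  have hsub : forall p : C -> R, (forall x y, p (Cplus x y) = p x + p y) -> p 0%C = 0 ->
      (forall x, Rabs (p x) <= Cmod x) -> is_series (fun k => p (a k)) (p l).
  { move=> p pD p0 pB; rewrite /is_series.
    apply: (filterlim_ext (fun n => p (@sum_n C_NormedModule a n))).
    - move=> n; exact: (@sum_n_m_morphism C_AbelianMonoid R_AbelianMonoid p a 0 n p0 pD).
    - apply: filterlim_comp ha _.
      apply/filterlim_locally => eps.
      apply: (@filter_imp _ (locally (T := C_NormedModule) l)); last exact: (@locally_ball_norm C_AbsRing C_NormedModule l eps).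
      move=> x hx.
      have e : p x - p l = p (Cplus x (Copp l)).
      { have := pD (Cplus x (Copp l)) l.
        have -> : Cplus (Cplus x (Copp l)) l = x by ring.
        lra. }
      rewrite /ball /= /AbsRing_ball /abs /= /minus /plus /opp /= -/(Rminus _ _) e.
      apply: Rle_lt_trans (pB _) _. exact: hx. }
  split; apply: hsub => //.
  - exact: re_le_Cmod.
  - exact: im_le_Cmod.
Qed.

Lemma C_Series_unique (a : C_seq) (l : C) :
  @is_series C_AbsRing C_NormedModule a l -> C_Series a = l.
Proof.
  move=> /is_series_Re_Im [h1 h2].
  rewrite /C_Series (is_series_unique _ _ h1) (is_series_unique _ _ h2).
  by case: l {h1 h2}.
Qed.

Lemma sum_n_le_Series (a : nat -> R) (n : nat) :
  (forall k, 0 <= a k) -> ex_series a -> sum_n a n <= Series a.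
Proof.
  move=> a0 ha; apply: (is_lim_seq_incr_compare (sum_n a)).
  - exact: Series_correct.
  - move=> k; rewrite sum_Sn /plus /=; have := a0 (S k); lra.
Qed.

Lemma sum_n_m_le_Series (a : nat -> R) (n m : nat) :
  (forall k, 0 <= a k) -> ex_series a -> sum_n_m a n m <= Series a.
Proof.
  move=> a0 ha; apply: Rle_trans (sum_n_le_Series _ m a0 ha).
  case: n => [|n]; first exact: Rle_refl.
  have pos i j : 0 <= sum_n_m a i j.
  { rewrite -(Rmult_0_r (INR (S j - i))) -(sum_n_m_const i j 0). exact: sum_n_m_le. }
  case: (le_lt_dec n m) => h.
  - rewrite /sum_n (sum_n_m_Chasles a 0 n m); try lia.
    rewrite /plus /=; have := pos 0%nat n; lra.
  - rewrite sum_n_m_zero; last lia. exact: pos.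
Qed.

Lemma Series_ge0 (a : nat -> R) : (forall k, 0 <= a k) -> ex_series a -> 0 <= Series a.
Proof.
  move=> a0 ha; apply: Rle_trans (sum_n_le_Series a 0 a0 ha); by rewrite sum_O.
Qed.

(** * Inner product identities and the Cauchy-Schwarz inequality *)

Lemma ip_plus_r (H : NormedModule C_AbsRing) (ip : H -> H -> C) (Hip : is_inner_product ip)
    (x y z : H) : ip x (plus y z) = Cplus (ip x y) (ip x z).
Proof.
  by rewrite (ip_conj _ Hip) (ip_plus_l _ Hip) Cplus_conj -!(ip_conj _ Hip).
Qed.

Lemma ip_scal_r (H : NormedModule C_AbsRing) (ip : H -> H -> C) (Hip : is_inner_product ip)
    (a : C) (x y : H) : ip x (scal a y) = Cmult (Cconj a) (ip x y).
Proof.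
  by rewrite (ip_conj _ Hip) (ip_scal_l _ Hip) Cmult_conj -!(ip_conj _ Hip).
Qed.

Lemma ip_zero_l (H : NormedModule C_AbsRing) (ip : H -> H -> C) (Hip : is_inner_product ip)
    (y : H) : ip zero y = 0%C.
Proof.
  rewrite -(@scal_zero_l C_Ring H zero) (ip_scal_l _ Hip); exact: Cmult_0_l.
Qed.

Lemma ip_zero_r (H : NormedModule C_AbsRing) (ip : H -> H -> C) (Hip : is_inner_product ip)
    (x : H) : ip x zero = 0%C.
Proof.
  rewrite (ip_conj _ Hip) (ip_zero_l _ _ Hip). apply: injective_projections => /=; ring.
Qed.

(** The common source of Cauchy-Schwarz, of the contraction estimate for the frame operator and of
    the Pythagorean identity. *)
Lemma norm_minus_scal_sq (H : NormedModule C_AbsRing) (ip : H -> H -> C)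
    (Hip : is_inner_product ip) (x y : H) (a : C) :
  norm (minus x (scal a y)) ^ 2 =
    norm x ^ 2 - 2 * Re (Cmult a (ip y x)) + Cmod a ^ 2 * norm y ^ 2.
Proof.
  have e : minus x (scal a y) = plus x (scal (Copp a) y).
  { by rewrite /minus -(@scal_opp_l C_Ring H). }
  rewrite -[LHS]/(Re (RtoC (norm (minus x (scal a y)) ^ 2))) -(ip_norm _ Hip) e (ip_plus_l _ Hip) !(ip_plus_r _ _ Hip) !(ip_scal_l _ Hip) !(ip_scal_r _ _ Hip)
    !(ip_norm _ Hip) Cmod2_alt (ip_conj _ Hip y x).
  case: (ip y x) => u v; case: a {e} => p q.
  rewrite /Cconj /Cmult /Cplus /Copp /Re /Im /RtoC /=; ring.
Qed.

Lemma cauchy_schwarz (H : NormedModule C_AbsRing) (ip : H -> H -> C)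
    (Hip : is_inner_product ip) (x y : H) : Cmod (ip x y) <= norm x * norm y.
Proof.
  have hn := Rmult_le_pos _ _ (norm_ge_0 x) (norm_ge_0 y).
  case: (Req_dec (norm y) 0) => [/norm_eq_zero e|hy].
  - by rewrite e in hn *; rewrite (ip_zero_r _ _ Hip) Cmod_0.
  - have hy2 : 0 < norm y ^ 2 by have := norm_ge_0 y; nra.
    apply: pow2_le => //.
    (* The scalar [<x, y> / |y|^2] gives the projection of [x] on [y]; the squared length of the
       remainder is nonnegative, which times [|y|^2] is the squared inequality. *)
    have h := norm_minus_scal_sq _ _ Hip x y (Cmult (RtoC (/ norm y ^ 2)) (ip x y)).
    have h0 := pow2_ge_0 (norm (minus x (scal (Cmult (RtoC (/ norm y ^ 2)) (ip x y)) y))).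
    move: h h0; rewrite Cmod_mult Cmod_R Rabs_pos_eq; last by left; apply: Rinv_0_lt_compat.
    rewrite (ip_conj _ Hip x y) -Cmult_assoc -Cmod2_conj.
    set p := Cmod _ => -> h0.
    have : 0 <= norm y ^ 2 * (norm x ^ 2 - / norm y ^ 2 * p ^ 2).
    { apply: Rmult_le_pos; first lra.
      apply: Rle_trans h0 _; right.
      rewrite /Cmult /RtoC /Re /=. field. lra. }
    have -> : norm y ^ 2 * (norm x ^ 2 - / norm y ^ 2 * p ^ 2) = norm x ^ 2 * norm y ^ 2 - p ^ 2
      by field; lra.
    rewrite Rpow_mult_distr; lra.
Qed.

Lemma is_linear_ip (H : NormedModule C_AbsRing) (ip : H -> H -> C)
    (Hip : is_inner_product ip) (w : H) :
  @is_linear C_AbsRing H C_NormedModule (fun x => ip x w).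
Proof.
  split.
  - move=> x y; exact: ip_plus_l.
  - move=> k x; exact: ip_scal_l.
  - exists (norm w + 1); split; first by have := norm_ge_0 w; lra.
    move=> x; apply: Rle_trans (cauchy_schwarz _ _ Hip x w) _.
    have := norm_ge_0 x; nra.
Qed.

(** * The synthesis operator of a Bessel sequence *)

Lemma bessel_sum_bound (H : NormedModule C_AbsRing) (ip : H -> H -> C)
    (Hip : is_inner_product ip) (f : nat -> H) (B : R) (c : C_seq) (n m : nat) :
  0 < B ->
  (forall x : H, ex_series (fun k => Cmod (ip x (f k)) ^ 2) /\
    Series (fun k => Cmod (ip x (f k)) ^ 2) <= B * norm x ^ 2) ->
  norm (sum_n_m (fun k => scal (c k) (f k)) n m) ^ 2 <=
    B * sum_n_m (fun k => Cmod (c k) ^ 2) n m.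
Proof.
  (* With [v] the sum, expand [<v, v>] and apply AM-GM,
     [|c| |q| <= B |c|^2 / 2 + |q|^2 / (2 B)] for [q = <v, f_k>]; the Bessel bound
     absorbs the second term into [|v|^2 / 2]. *)
  move=> B0 hB; set v := sum_n_m _ n m.
  have [hex hle] := hB v.
  have e : norm v ^ 2 = sum_n_m (fun k => Re (Cmult (c k) (ip (f k) v))) n m.
  { rewrite -[LHS]/(Re (RtoC (norm v ^ 2))) -(ip_norm _ Hip).
    rewrite {1}/v (@sum_n_m_morphism H R_AbelianMonoid (fun x => Re (ip x v))).
    - apply: sum_n_m_ext => k; by rewrite (ip_scal_l _ Hip).
    - by rewrite (ip_zero_l _ _ Hip).
    - by move=> x y; rewrite (ip_plus_l _ Hip). }
  have h1 : norm v ^ 2 <= sum_n_m (fun k => plus (mult (B / 2) (Cmod (c k) ^ 2))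
                           (mult (/ (2 * B)) (Cmod (ip v (f k)) ^ 2))) n m.
  { rewrite e; apply: sum_n_m_le => k.
    apply: Rle_trans (Rle_abs _) _; apply: Rle_trans (re_le_Cmod _) _.
    rewrite Cmod_mult (ip_conj _ Hip v) Cmod_conj /plus /mult /=.
    set p := Cmod (c k); set q := Cmod (ip v (f k)).
    have : 0 <= / (2 * B) * (B * p - q) ^ 2.
    { apply: Rmult_le_pos; last exact: pow2_ge_0.
      left; apply: Rinv_0_lt_compat; lra. }
    have -> : / (2 * B) * (B * p - q) ^ 2 = B / 2 * (p * (p * 1)) + / (2 * B) * (q * (q * 1)) - p * q
      by field; lra.
    lra. }
  move: h1; rewrite sum_n_m_plus !sum_n_m_mult_l => h1.
  have {}h1 : norm v ^ 2 <= B / 2 * sum_n_m (fun k => Cmod (c k) ^ 2) n m +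
    / (2 * B) * sum_n_m (fun k => Cmod (ip v (f k)) ^ 2) n m := h1.
  have h2 := sum_n_m_le_Series (fun k => Cmod (ip v (f k)) ^ 2) n m (fun k => pow2_ge_0 _) hex.
  have h3 : / (2 * B) * sum_n_m (fun k => Cmod (ip v (f k)) ^ 2) n m <= norm v ^ 2 / 2.
  { have -> : norm v ^ 2 / 2 = / (2 * B) * (B * norm v ^ 2) by field; lra.
    apply: Rmult_le_compat_l; last lra.
    left; apply: Rinv_0_lt_compat; lra. }
  lra.
Qed.

(* An unspecified vector when the series diverges. *)
Definition synth {H : NormedModule C_AbsRing} (f : nat -> H) (c : C_seq) : H :=
  epsilon (inhabits zero) (is_series (fun k => scal (c k) (f k))).

Lemma synth_unique (H : NormedModule C_AbsRing) (f : nat -> H) (c : C_seq) (s : H) :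
  is_series (fun k => scal (c k) (f k)) s -> synth f c = s.
Proof.
  move=> h; apply: is_series_unique_normed (h).
  exact: (epsilon_spec (inhabits zero) (is_series _) (ex_intro _ s h)).
Qed.

(** The bound on finite sections turns the Cauchy criterion for [|c_k|^2] into the one for the
    vector series; completeness of [H] gives the limit. *)
Lemma synth_series (H : CompleteNormedModule C_AbsRing) (ip : H -> H -> C)
    (Hip : is_inner_product ip) (f : nat -> H) (c : C_seq) :
  is_bessel ip f -> in_l2 c -> is_series (fun k => scal (c k) (f k)) (synth f c).
Proof.
  move=> [B [B0 hB]] hc; apply: epsilon_spec.
  apply: ex_series_Cauchy => eps.
  have e2 : 0 < eps ^ 2 / B.
  { apply: Rdiv_lt_0_compat => //; apply: pow_lt; exact: cond_pos. }
  have [N hN] := Cauchy_ex_series _ hc (mkposreal _ e2).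
  exists N => n m hn hm.
  have h := bessel_sum_bound _ _ Hip f B c n m B0 hB.
  have := Rle_lt_trans _ _ _ (Rle_abs _) (hN n m hn hm) => /= h'.
  have h'' : B * sum_n_m (fun k => Cmod (c k) ^ 2) n m < eps ^ 2.
  { have -> : pos eps ^ 2 = B * (eps * (eps * 1) / B) by field; lra.
    exact: Rmult_lt_compat_l. }
  apply: Rnot_le_lt => h3.
  have h4 := pow_incr eps _ 2 (conj (Rlt_le _ _ (cond_pos eps)) h3).
  exact: (Rlt_irrefl _ (Rle_lt_trans _ _ _ h4 (Rle_lt_trans _ _ _ h h''))).
Qed.

Lemma synth_norm (H : CompleteNormedModule C_AbsRing) (ip : H -> H -> C)
    (Hip : is_inner_product ip) (f : nat -> H) (B : R) (c : C_seq) :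
  0 < B ->
  (forall x : H, ex_series (fun k => Cmod (ip x (f k)) ^ 2) /\
    Series (fun k => Cmod (ip x (f k)) ^ 2) <= B * norm x ^ 2) ->
  in_l2 c ->
  norm (synth f c) ^ 2 <= B * Series (fun k => Cmod (c k) ^ 2).
Proof.
  move=> B0 hB hc.
  have hs := synth_series _ _ Hip f c (ex_intro _ B (conj B0 hB)) hc.
  have S0 := Series_ge0 _ (fun k => pow2_ge_0 (Cmod (c k))) hc.
  have BS0 : 0 <= B * Series (fun k => Cmod (c k) ^ 2) by apply: Rmult_le_pos; lra.
  (* The bound is written as a square so that the limit can be taken on norms, where continuity is
     available. *)
  rewrite -(pow2_sqrt _ BS0).
  apply: pow_incr; split; first exact: norm_ge_0.
  apply: (is_lim_seq_le (fun n => norm (sum_n (fun k => scal (c k) (f k)) n))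
           (fun=> sqrt (B * Series (fun k => Cmod (c k) ^ 2)))
           (norm (synth f c)) (sqrt _)); last exact: is_lim_seq_const.
  - move=> n; apply: pow2_le; first exact: sqrt_pos.
    rewrite (pow2_sqrt _ BS0).
    apply: Rle_trans (bessel_sum_bound _ _ Hip f B c 0 n B0 hB) _.
    apply: Rmult_le_compat_l; first lra.
    apply: sum_n_m_le_Series => // k; exact: pow2_ge_0.
  - apply: filterlim_comp hs _; exact: filterlim_norm.
Qed.

Lemma in_l2_scal (a : C) (c : C_seq) : in_l2 c -> in_l2 (fun k => Cmult a (c k)).
Proof.
  move=> hc; apply: (ex_series_ext (fun k => Cmod a ^ 2 * Cmod (c k) ^ 2)).
  - move=> k; rewrite Cmod_mult /=; ring.
  - exact: (@ex_series_scal R_AbsRing R_NormedModule).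
Qed.

Lemma in_l2_plus (c d : C_seq) : in_l2 c -> in_l2 d -> in_l2 (fun k => Cplus (c k) (d k)).
Proof.
  move=> hc hd.
  apply: (@ex_series_le R_AbsRing R_CompleteNormedModule _
            (fun k => 2 * Cmod (c k) ^ 2 + 2 * Cmod (d k) ^ 2)).
  - move=> k; rewrite /norm /= /abs /= Rabs_pos_eq.
    + have := Cmod_triangle (c k) (d k).
      have := Cmod_ge_0 (Cplus (c k) (d k)).
      have := Cmod_ge_0 (c k); have := Cmod_ge_0 (d k).
      set p := Cmod (c k); set q := Cmod (d k); set r := Cmod _ => *.
      have : 0 <= (p - q) ^ 2 by exact: pow2_ge_0.
      nra.
    + have := pow2_ge_0 (Cmod (Cplus (c k) (d k))); simpl; lra.
  - apply: (@ex_series_plus R_AbsRing R_NormedModule);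
      exact: (@ex_series_scal R_AbsRing R_NormedModule).
Qed.

Lemma synth_plus (H : CompleteNormedModule C_AbsRing) (ip : H -> H -> C)
    (Hip : is_inner_product ip) (f : nat -> H) (c d : C_seq) :
  is_bessel ip f -> in_l2 c -> in_l2 d ->
  synth f (fun k => Cplus (c k) (d k)) = plus (synth f c) (synth f d).
Proof.
  move=> hf hc hd; apply: synth_unique.
  apply: (is_series_ext (fun k => plus (scal (c k) (f k)) (scal (d k) (f k)))).
  - move=> k; by rewrite -(@scal_distr_r C_Ring H).
  - apply: is_series_plus; exact: (synth_series _ _ Hip).
Qed.

Lemma synth_scal (H : CompleteNormedModule C_AbsRing) (ip : H -> H -> C)
    (Hip : is_inner_product ip) (f : nat -> H) (a : C) (c : C_seq) :
  is_bessel ip f -> in_l2 c ->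
  synth f (fun k => Cmult a (c k)) = scal a (synth f c).
Proof.
  move=> hf hc; apply: synth_unique.
  apply: (is_series_ext (fun k => scal a (scal (c k) (f k)))).
  - move=> k; by rewrite (@scal_assoc C_Ring H).
  - apply: is_series_scal; exact: (synth_series _ _ Hip).
Qed.

Lemma ip_synth (H : CompleteNormedModule C_AbsRing) (ip : H -> H -> C)
    (Hip : is_inner_product ip) (f : nat -> H) (c : C_seq) (w : H) :
  is_bessel ip f -> in_l2 c ->
  @is_series C_AbsRing C_NormedModule (fun k => Cmult (c k) (ip (f k) w)) (ip (synth f c) w).
Proof.
  move=> hf hc.
  apply: (is_series_ext (fun k => ip (scal (c k) (f k)) w)).
  - move=> k; exact: ip_scal_l.
  - exact (is_series_linear _ _ _ _ _ (is_linear_ip _ _ Hip w) (synth_series _ _ Hip f c hf hc)).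
Qed.

Lemma bessel_l2 (H : NormedModule C_AbsRing) (ip : H -> H -> C) (f : nat -> H) (x : H) :
  is_bessel ip f -> in_l2 (fun k => ip x (f k)).
Proof. by move=> [B [_ h]]; case: (h x). Qed.

(** Used twice: with [h = f] it treats the frame operator, and with an orthonormal basis for [h] it
    treats the map that carries this basis to [f]. *)
Lemma is_linear_synth_analysis (H : CompleteNormedModule C_AbsRing) (ip : H -> H -> C)
    (Hip : is_inner_product ip) (f h : nat -> H) :
  is_bessel ip f -> is_bessel ip h ->
  is_linear (fun x => synth f (fun k => ip x (h k))).
Proof.
  move=> hf hh; split.
  - move=> x y; rewrite -(synth_plus _ _ Hip) //; try exact: bessel_l2.
    congr (synth f _); apply: functional_extensionality => k; exact: ip_plus_l.
  - move=> a x; rewrite -(synth_scal _ _ Hip) //; try exact: bessel_l2.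
    congr (synth f _); apply: functional_extensionality => k; exact: ip_scal_l.
  - move: (hf) (hh) => [B [B0 hB]] [D [D0 hD]].
    exists (sqrt (B * D)); split; first by apply: sqrt_lt_R0; nra.
    move=> x; apply: pow2_le.
    { apply: Rmult_le_pos; [exact: sqrt_pos|exact: norm_ge_0]. }
    rewrite Rpow_mult_distr pow2_sqrt; last nra.
    apply: Rle_trans (synth_norm _ _ Hip f B _ B0 hB (bessel_l2 _ _ _ _ hh)) _.
    rewrite Rmult_assoc; apply: Rmult_le_compat_l; first lra.
    by case: (hD x).
Qed.

(** * Surjectivity of the frame operator *)

(* [I - t L] is a contraction, so [z = t sum_n (I - t L)^n y] solves [L z = y]. *)
Lemma neumann_onto (H : CompleteNormedModule C_AbsRing) (L : H -> H) (t : C) (r : R) :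
  is_linear L -> 0 <= r < 1 ->
  (forall x, norm (minus x (scal t (L x))) <= r * norm x) ->
  forall y, exists z, L z = y.
Proof.
  move=> hL hr hc y.
  pose u := fix u n := match n with
    | O => y | S n => minus (u n) (scal t (L (u n))) end.
  have hu : forall n, norm (u n) <= norm y * r ^ n.
  { elim=> [|n IH] /=; first lra.
    apply: Rle_trans (hc _) _.
    have -> : norm y * (r * r ^ n) = r * (norm y * r ^ n) by ring.
    apply: Rmult_le_compat_l => //; lra. }
  have hr1 : Rabs r < 1 by rewrite Rabs_pos_eq; lra.
  have [z hz] : ex_series u.
  { apply: ex_series_le hu _.
    apply: (@ex_series_scal R_AbsRing R_NormedModule (norm y)). exact: ex_series_geom. }
  exists (scal t z).
  apply: (is_series_unique_normed _ (fun n => scal t (L (u n)))).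
  - rewrite (linear_scal _ hL); apply: is_series_scal; exact: is_series_linear.
  (* The series telescopes: [t L (u n) = u n - u (n+1)], so its partial sums are [y - u (n+1)], and
     [u] tends to zero. *)
  - apply: (filterlim_ext (fun n => minus y (u (S n)))).
    + elim=> [|n IH].
      * rewrite sum_O /= /minus opp_plus opp_opp plus_assoc plus_opp_r; exact: plus_zero_l.
      * rewrite sum_Sn -IH [u (S (S n))]/=; set v := u (S n).
        rewrite /minus opp_plus opp_opp !plus_assoc; congr (plus _ _).
    + have h0 : filterlim (fun n => opp (u (S n))) eventually (locally (zero : H)).
      { apply: filterlim_norm_zero.
        apply: (is_lim_seq_le_le (fun=> 0) _ (fun n => norm y * r ^ (S n)) 0).
        - move=> n; split; first exact: norm_ge_0.
          rewrite norm_opp; exact: hu.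
        - exact: is_lim_seq_const.
        - rewrite -(Rmult_0_r (norm y)).
          apply: (is_lim_seq_scal_l (fun n => r ^ (S n)) (norm y) 0).
          apply: (is_lim_seq_incr_1 (fun n => r ^ n) 0).1. exact: is_lim_seq_geom. }
      rewrite -[X in locally X]plus_zero_r.
      exact: (filterlim_comp_2 (fun=> y) _ plus (filterlim_const y) h0 (filterlim_plus y (zero : H))).
Qed.

Lemma frame_is_bessel (H : NormedModule C_AbsRing) (ip : H -> H -> C) (f : nat -> H) :
  is_frame ip f -> is_bessel ip f.
Proof.
  move=> [A [B [A0 [B0 h]]]]; exists B; split=> // x.
  by case: (h x) => h1 [_ h2].
Qed.

(** For the frame operator [F], [|F x|^2 <= B <F x, x>] and [A |x|^2 <= <F x, x>]; expanding the
    square gives [|x - F x / B|^2 <= (1 - A/B) |x|^2], so the Neumann series applies. *)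
Lemma frame_operator_onto (H : CompleteNormedModule C_AbsRing) (ip : H -> H -> C)
    (Hip : is_inner_product ip) (f : nat -> H) :
  is_frame ip f -> forall y, exists z, synth f (fun k => ip z (f k)) = y.
Proof.
  move=> hfr; have hf := frame_is_bessel _ _ _ hfr.
  move: hfr => [A [B [A0 [B0 h]]]].
  (* In the zero space [A] may exceed [B]; the maximum with 0 keeps the square root of [q]
     meaningful. *)
  set q := Rmax 0 (1 - A / B).
  have AB : 0 < A / B by apply: Rdiv_lt_0_compat.
  have q0 : 0 <= q < 1 by split; [exact: Rmax_l | apply: Rmax_lub_lt; lra].
  apply: (neumann_onto H _ (RtoC (/ B)) (sqrt q)).
  - exact: is_linear_synth_analysis.
  - split; first exact: sqrt_pos.
    rewrite -sqrt_1; apply: sqrt_lt_1_alt; lra.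
  - move=> x.
    apply: pow2_le; first by apply: Rmult_le_pos; [exact: sqrt_pos|exact: norm_ge_0].
    rewrite Rpow_mult_distr pow2_sqrt; last lra.
    have [hex [hlo hup]] := h x.
    rewrite (norm_minus_scal_sq _ _ Hip) Cmod_R Rabs_pos_eq; last by left; apply: Rinv_0_lt_compat.
    have hn := synth_norm _ _ Hip f B _ B0 (fun x => conj (h x).1 (h x).2.2)
      (bessel_l2 _ _ f x hf).
    have hS : Re (ip (synth f (fun k => ip x (f k))) x) = Series (fun k => Cmod (ip x (f k)) ^ 2).
    { have [hs _] := is_series_Re_Im _ _ (ip_synth _ _ Hip f _ x hf (bessel_l2 _ _ f x hf)).
      rewrite -(is_series_unique _ _ hs); apply: Series_ext => k.
      by rewrite (ip_conj _ Hip x) -Cmod2_conj. }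
    have -> : Re (Cmult (RtoC (/ B)) (ip (synth f (fun k => ip x (f k))) x))
       = / B * Re (ip (synth f (fun k => ip x (f k))) x)
      by rewrite /Cmult /RtoC /Re /=; ring.
    rewrite hS.
    set Q := Series _ in hlo hup hn *; set N := norm (synth _ _) in hn *.
    have i0 : 0 < / B by apply: Rinv_0_lt_compat.
    have h1 : (/ B) ^ 2 * N ^ 2 <= / B * Q.
    { have -> : / B * Q = (/ B) ^ 2 * (B * Q) by field; lra.
      apply: Rmult_le_compat_l => //; exact: pow2_ge_0. }
    have h2 : A / B * norm x ^ 2 <= / B * Q.
    { have -> : A / B * norm x ^ 2 = / B * (A * norm x ^ 2) by field; lra.
      apply: Rmult_le_compat_l => //; lra. }
    have h3 : (1 - A / B) * norm x ^ 2 <= q * norm x ^ 2.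
    { apply: Rmult_le_compat_r; [exact: pow2_ge_0|exact: Rmax_r]. }
    lra.
Qed.

(** * Consequences of invertibility of the cross-Gram operator *)

(** The factorisation [G = C_g T_f] on l2, by continuity of the inner product in its first
    argument. *)
Lemma cross_gram_synth (H : CompleteNormedModule C_AbsRing) (ip : H -> H -> C)
    (Hip : is_inner_product ip) (f g : nat -> H) (c : C_seq) :
  is_bessel ip f -> in_l2 c ->
  matrix_op (cross_gram ip f g) c = fun j => ip (synth f c) (g j).
Proof.
  move=> hf hc; apply: functional_extensionality => j.
  apply: C_Series_unique; exact: (ip_synth _ _ Hip).
Qed.

Lemma frame_of_synth_onto (H : CompleteNormedModule C_AbsRing) (ip : H -> H -> C)
    (Hip : is_inner_product ip) (f g : nat -> H) :
  is_bessel ip f -> is_bessel ip g -> l2_invertible (matrix_op (cross_gram ip f g)) ->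
  (forall x, exists c, in_l2 c /\ synth f c = x) -> is_frame ip g.
Proof.
  move=> hf hg [S [[_ [K hK]] [hST _]]] onto.
  move: (hf) (hg) => [B [B0 hB]] [D [D0 hD]].
  (* [K] comes without a sign; raising it to at least 1 makes [/ (B * K' ^ 2)] a positive lower
     frame bound. *)
  set K' := Rmax K 1.
  have K1 : 1 <= K' by exact: Rmax_r.
  have K2 : 0 < K' ^ 2 by apply: pow_lt; lra.
  exists (/ (B * K' ^ 2)), D; split.
  { apply: Rinv_0_lt_compat; exact: Rmult_lt_0_compat. }
  split=> // x; have [hex hle] := hD x; split=> //; split=> //.
  have [c [hc e]] := onto x.
  have eT := cross_gram_synth _ _ Hip f g c hf hc; rewrite e in eT.
  have := hK _ hex.
  rewrite -eT (functional_extensionality _ _ (hST c hc)) eT /l2_norm.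
  have hx := synth_norm _ _ Hip f B c B0 hB hc; rewrite e in hx.
  have p0 := Series_ge0 _ (fun k => pow2_ge_0 (Cmod (c k))) hc.
  have q0 := Series_ge0 _ (fun k => pow2_ge_0 (Cmod (ip x (g k)))) hex.
  move: hx p0 q0; set p := Series _; set q := Series _ => hx p0 q0 hpq.
  have h1 : p <= K' ^ 2 * q.
  { rewrite -(pow2_sqrt _ p0) -(pow2_sqrt _ q0) -Rpow_mult_distr.
    apply: pow_incr; split; first exact: sqrt_pos.
    apply: Rle_trans hpq _; apply: Rmult_le_compat_r; [exact: sqrt_pos|exact: Rmax_l]. }
  apply: (Rmult_le_reg_l (B * K' ^ 2)); first exact: Rmult_lt_0_compat.
  have -> : B * K' ^ 2 * (/ (B * K' ^ 2) * norm x ^ 2) = norm x ^ 2 by field; lra.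
  apply: Rle_trans hx _; rewrite Rmult_assoc; apply: Rmult_le_compat_l => //; lra.
Qed.

(** Surjectivity of [G] gives [d] with [<T_f d, g_j> = c_j]; then [0 = <T_g c, T_f d>] is the sum of
    [c_j] times its conjugate, that is [|c|^2]. *)
Lemma synth_injective (H : CompleteNormedModule C_AbsRing) (ip : H -> H -> C)
    (Hip : is_inner_product ip) (f g : nat -> H) (c : C_seq) :
  is_bessel ip f -> is_bessel ip g -> l2_invertible (matrix_op (cross_gram ip f g)) ->
  in_l2 c -> synth g c = zero -> forall k, c k = 0%C.
Proof.
  move=> hf hg [S [[hS _] [_ hTS]]] hc h0 k.
  have e := cross_gram_synth _ _ Hip f g _ hf (hS c hc).
  have ec j : ip (synth f (S c)) (g j) = c j by rewrite -(hTS c hc j) e.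
  have [hs _] := is_series_Re_Im _ _ (ip_synth _ _ Hip g c (synth f (S c)) hg hc).
  rewrite h0 (ip_zero_l _ _ Hip) in hs.
  (* A single term is at most the whole nonnegative series, whose sum is 0. *)
  have h1 : Cmod (c k) ^ 2 <= 0.
  { rewrite -[X in _ <= X]/(Re 0%C) -(is_series_unique _ _ hs).
    rewrite -{1}(sum_n_n (G := R_AbelianMonoid) (fun j => Cmod (c j) ^ 2) k).
    rewrite (Series_ext _ (fun j => Cmod (c j) ^ 2)).
    - apply: sum_n_m_le_Series => // j; exact: pow2_ge_0.
    - move=> j; by rewrite (ip_conj _ Hip) ec -Cmod2_conj. }
  apply: Cmod_eq_0; have := Cmod_ge_0 (c k); nra.
Qed.

(** * Orthonormal sequences and bases *)

Lemma is_series_single (V : NormedModule C_AbsRing) (a : nat -> V) (j : nat) :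
  (forall k, k <> j -> a k = zero) -> is_series a (a j).
Proof.
  move=> h; apply: (filterlim_ext_loc (fun=> a j)); last exact: filterlim_const.
  have z n m : ((m < j) \/ (j < n))%nat -> sum_n_m a n m = zero.
  { move=> hj; rewrite (sum_n_m_ext_loc _ (fun=> zero)) ?sum_n_m_const_zero // => k hk.
    apply: h; lia. }
  exists j => n hn; rewrite /sum_n (sum_n_m_Chasles a 0 j n); try lia.
  rewrite (z (S j) n); last lia.
  rewrite plus_zero_r; case: j {hn} h z => [|j] h z; first by rewrite sum_n_n.
  rewrite sum_n_Sm; last lia.
  rewrite (z 0%nat j); last lia.
  by rewrite plus_zero_l.
Qed.

(** If [y] were nonzero, some [s] in the span would lie within [|y|] of it. Since [s] is orthogonal
    to [y], [<y - s, y> = |y|^2], while Cauchy-Schwarz makes this strictly smaller. *)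
Lemma orthogonal_complete (H : NormedModule C_AbsRing) (ip : H -> H -> C)
    (Hip : is_inner_product ip) (e : nat -> H) (y : H) :
  complete_seq e -> (forall k, ip y (e k) = 0%C) -> y = zero.
Proof.
  move=> he h; apply: norm_eq_zero.
  case: (Rle_lt_or_eq_dec _ _ (norm_ge_0 y)) => // y0; exfalso.
  have [s [[n [c hs]] hlt]] := he y (mkposreal _ y0).
  have es : ip s y = 0%C.
  { rewrite hs /sum_n (@sum_n_m_morphism H C_AbelianMonoid (fun x => ip x y)).
    - rewrite (sum_n_m_ext _ (fun=> zero)) ?sum_n_m_const_zero // => k.
      rewrite (ip_scal_l _ Hip) (ip_conj _ Hip y) h.
      apply: injective_projections => /=; ring.
    - exact: (ip_zero_l _ _ Hip).
    - move=> u v; exact: ip_plus_l. }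
  have en : ip (minus y s) y = RtoC (norm y ^ 2).
  { rewrite /minus -(@scal_opp_one C_Ring H) (ip_plus_l _ Hip) (ip_scal_l _ Hip) es (ip_norm _ Hip).
    rewrite Cmult_0_r; exact: Cplus_0_r. }
  have := cauchy_schwarz _ _ Hip (minus y s) y.
  rewrite en Cmod_R Rabs_pos_eq; last exact: pow2_ge_0.
  move: hlt => /=; nra.
Qed.

Lemma orthonormal_pythagoras (H : NormedModule C_AbsRing) (ip : H -> H -> C)
    (Hip : is_inner_product ip) (e : nat -> H) (x : H) (n : nat) :
  is_orthonormal ip e ->
  norm (minus x (sum_n (fun k => scal (ip x (e k)) (e k)) n)) ^ 2 =
    norm x ^ 2 - sum_n (fun k => Cmod (ip x (e k)) ^ 2) n.
Proof.
  move=> he.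
  have ne k : norm (e k) ^ 2 = 1.
  { rewrite -[LHS]/(Re (RtoC (norm (e k) ^ 2))) -(ip_norm _ Hip) he.
    by rewrite PeanoNat.Nat.eqb_refl. }
  (* One coefficient is removed at a time from a residual [r] that still has the same [k]-th
     coefficient as [x]. *)
  have step k r : ip r (e k) = ip x (e k) ->
    norm (minus r (scal (ip x (e k)) (e k))) ^ 2 = norm r ^ 2 - Cmod (ip x (e k)) ^ 2.
  { move=> er; rewrite (norm_minus_scal_sq _ _ Hip) ne (ip_conj _ Hip r) er -Cmod2_conj.
    rewrite -[Re (RtoC _)]/(Cmod (ip x (e k)) ^ 2); ring. }
  elim: n => [|n IH]; first by rewrite !sum_O step.
  rewrite !sum_Sn /minus opp_plus plus_assoc -!/(minus _ _) step.
  - rewrite IH /plus /=; ring.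
  (* The terms already subtracted are orthogonal to [e (S n)], so the residual keeps that
     coefficient of [x]. *)
  - rewrite /minus -(@scal_opp_one C_Ring H) (ip_plus_l _ Hip) (ip_scal_l _ Hip).
    rewrite (@sum_n_m_morphism H C_AbelianMonoid (fun u => ip u (e (S n)))).
    + rewrite (sum_n_m_ext_loc _ (fun=> zero)) ?sum_n_m_const_zero.
      * rewrite Cmult_0_r; exact: Cplus_0_r.
      * move=> k hk; rewrite (ip_scal_l _ Hip) he.
        case: PeanoNat.Nat.eqb_spec => [|_]; first lia.
        exact: Cmult_0_r.
    + exact: (ip_zero_l _ _ Hip).
    + move=> u v; exact: ip_plus_l.
Qed.

Lemma orthonormal_bessel (H : NormedModule C_AbsRing) (ip : H -> H -> C)
    (Hip : is_inner_product ip) (e : nat -> H) :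
  is_orthonormal ip e -> is_bessel ip e.
Proof.
  move=> he; exists 1; split; first lra; move=> x.
  have hb n : sum_n (fun k => Cmod (ip x (e k)) ^ 2) n <= norm x ^ 2.
  { have := orthonormal_pythagoras _ _ Hip e x n he.
    have := pow2_ge_0 (norm (minus x (sum_n (fun k => scal (ip x (e k)) (e k)) n))); lra. }
  have [l hl] : ex_finite_lim_seq (sum_n (fun k => Cmod (ip x (e k)) ^ 2)).
  { apply: (ex_finite_lim_seq_incr _ (norm x ^ 2)) => // n.
    rewrite sum_Sn /plus -[X in X <= _]Rplus_0_r; apply: Rplus_le_compat_l; exact: pow2_ge_0. }
  split; first by exists l.
  rewrite (is_series_unique _ l hl) Rmult_1_l.
  exact: (is_lim_seq_le _ _ l (norm x ^ 2) hb hl (is_lim_seq_const _)).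
Qed.

Lemma ip_synth_orthonormal (H : CompleteNormedModule C_AbsRing) (ip : H -> H -> C)
    (Hip : is_inner_product ip) (e : nat -> H) (c : C_seq) (j : nat) :
  is_orthonormal ip e -> in_l2 c -> ip (synth e c) (e j) = c j.
Proof.
  move=> he hc; have hb := orthonormal_bessel _ _ Hip e he.
  apply: (is_series_unique_normed C_NormedModule _ _ _ (ip_synth _ _ Hip e c (e j) hb hc)).
  have -> : c j = Cmult (c j) (ip (e j) (e j))
    by rewrite he PeanoNat.Nat.eqb_refl Cmult_1_r.
  apply: (is_series_single C_NormedModule (fun k => Cmult (c k) (ip (e k) (e j)))) => k hk.
  rewrite he; case: PeanoNat.Nat.eqb_spec => [//|_]; exact: Cmult_0_r.
Qed.

(** The difference between [x] and its expansion is orthogonal to every [e k], hence zero by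
    completeness of [e]. *)
Lemma orthonormal_basis_expansion (H : CompleteNormedModule C_AbsRing) (ip : H -> H -> C)
    (Hip : is_inner_product ip) (e : nat -> H) (x : H) :
  is_orthonormal_basis ip e -> synth e (fun k => ip x (e k)) = x.
Proof.
  move=> [he hc]; have hb := orthonormal_bessel _ _ Hip e he.
  apply/eq_sym; apply: (@plus_reg_r H (opp (synth e (fun k => ip x (e k))))).
  rewrite plus_opp_r; apply: (orthogonal_complete _ _ Hip e) => // k.
  rewrite -(@scal_opp_one C_Ring H) (ip_plus_l _ Hip) (ip_scal_l _ Hip).
  rewrite (ip_synth_orthonormal _ _ Hip) //; last exact: bessel_l2.
  rewrite /opp /one /=; ring.
Qed.

(** * Riesz bases and the two implications *)

(** Expanding the preimage of [x] under [U] in the basis [e] and applying [U] termwise expresses [x]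
    through [f]. *)
Lemma riesz_synth_onto (H : CompleteNormedModule C_AbsRing) (ip : H -> H -> C)
    (Hip : is_inner_product ip) (f : nat -> H) :
  is_riesz_basis ip f -> forall x, exists c, in_l2 c /\ synth f c = x.
Proof.
  move=> [e [U [he [hU [[U' _ UK] hf]]]]] x.
  have hb := orthonormal_bessel _ _ Hip e he.1.
  exists (fun k => ip (U' x) (e k)); split; first exact: bessel_l2.
  apply: synth_unique.
  apply: (is_series_ext (fun k => U (scal (ip (U' x) (e k)) (e k)))).
  - move=> k; by rewrite (linear_scal _ hU) hf.
  - rewrite -{2}(UK x) -{2}(orthonormal_basis_expansion _ _ Hip e (U' x) he).
    apply: is_series_linear => //; apply: (synth_series _ _ Hip) => //; exact: bessel_l2.
Qed.

(** [bijective] carries an explicit two-sided inverse, obtained here by choosing preimages. *)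
Lemma inj_surj_bijective (A B : Type) (u : A -> B) :
  injective u -> (forall y, exists x, u x = y) -> bijective u.
Proof.
  move=> hi hs.
  pose v y := proj1_sig (constructive_indefinite_description _ (hs y)).
  have vK : cancel v u by move=> y; exact: proj2_sig (constructive_indefinite_description _ (hs y)).
  exists v => // x; apply: hi; exact: vK.
Qed.

Theorem theorem2p11 (H : CompleteNormedModule C_AbsRing) (ip : H -> H -> C)
    (Hip : is_inner_product ip) (f g : nat -> H)
    (Hf : is_bessel ip f) (Hg : is_bessel ip g)
    (Hbdd : matrix_bounded (cross_gram ip f g))
    (Hinv : l2_invertible (matrix_op (cross_gram ip f g))) :
  (is_riesz_basis ip f -> is_riesz_basis ip g) /\
  (is_frame ip f -> complete_seq g -> is_frame ip g).
Proof.
  split=> [hr|hfr _]; last first.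
  - apply: (frame_of_synth_onto _ _ Hip f g Hf Hg Hinv) => x.
    have [z hz] := frame_operator_onto _ _ Hip f hfr x.
    (* The frame coefficients of a preimage of [x] under the frame operator synthesise [x]. *)
    exists (fun k => ip z (f k)); split=> //; exact: bessel_l2.
  - have hgf := frame_of_synth_onto _ _ Hip f g Hf Hg Hinv (riesz_synth_onto _ _ Hip f hr).
    move: hr => [e [_ [he _]]].
    have hb := orthonormal_bessel _ _ Hip e he.1.
    have hV := is_linear_synth_analysis _ _ Hip g e Hg hb.
    (* The orthonormal basis underlying [f] is reused, with [U = T_g C_e]. *)
    exists e, (fun x => synth g (fun k => ip x (e k))); split=> //; split=> //; split.
    + apply: inj_surj_bijective.
      (* By injectivity of [T_g] all coefficients of [x - y] in [e] vanish, so [x - y] is orthogonal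
         to a complete sequence. *)
      * move=> x y hxy; apply: (@plus_reg_r H (opp y)); rewrite plus_opp_r.
        apply: (orthogonal_complete _ _ Hip e _ he.2).
        apply: (synth_injective _ _ Hip f g _ Hf Hg Hinv); first exact: bessel_l2.
        rewrite -[plus x _]/(minus x y).
        have := linear_minus _ x y hV => /= ->.
        rewrite hxy; exact: plus_opp_r.
      * move=> y; have [z hz] := frame_operator_onto _ _ Hip g hgf y.
        have hl := bessel_l2 _ _ g z Hg.
        (* As [g] is already a frame, [y = T_g c] with [c = C_g z]; the vector with coefficients [c]
           in [e] is then a preimage of [y]. *)
        exists (synth e (fun k => ip z (g k))); rewrite -hz.
        congr (synth g _); apply: functional_extensionality => k.
        exact: (ip_synth_orthonormal _ _ Hip e _ k he.1 hl).
    (* By orthonormality only the [k]-th term of the series for [U (e k)] survives. *)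
    + move=> k; apply/eq_sym; apply: synth_unique.
      have -> : g k = scal (ip (e k) (e k)) (g k)
        by rewrite he.1 PeanoNat.Nat.eqb_refl; rewrite (@scal_one C_Ring H).
      apply: (is_series_single _ (fun j => scal (ip (e k) (e j)) (g j))) => j hj.
      rewrite he.1; case: PeanoNat.Nat.eqb_spec => [?|_]; first by subst.
      exact: (@scal_zero_l C_Ring H).
Qed.
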